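(* Let $Q_z$ be the linear operator on $\mathbb{C}[x_1,\ldots,x_n]^{S_n}$ defined by $Q_z\bar E_\lambda=q_\lambda(z)\bar E_\lambda$ for all partitions $\lambda$ of length $n$, where $q_\lambda(z)=\bar E_\lambda(z,1,\ldots,1)=\prod_{j=1}^n\bigl(1+\tfrac{z-1}{n}j\bigr)^{\lambda_j-\lambda_{j+1}}$ (with $\lambda_{n+1}=0$), and let $\mathcal S_n=\rho_0Q_{z_1}\cdots Q_{z_n}$ be the separating operator, so that $\mathcal S_n:\bar E_\lambda\mapsto\prod_{j=1}^nq_\lambda(z_j)$. Then for each $k=1,\ldots,n$ there exists a uniquely defined linear operator $$\mathcal A_k:\mathbb{C}[x_1,\ldots,x_k]^{S_k}\to\mathbb{C}[x_1,\ldots,x_{k-1}]^{S_{k-1}}\otimes\mathbb{C}[z_k]$$ satisfying $$\rho_{k-1}Q_{z_k}=\mathcal A_k\rho_k\qquad\text{on }\ \mathbb{C}[x_1,\ldots,x_n]^{S_n},$$ and thus $$\mathcal S_n=\mathcal A_1\mathcal A_2\cdots\mathcal A_n.$$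
   Context: Partitions of length $n$ are $\lambda=(\lambda_1,\ldots,\lambda_n)\in\mathbb{N}^n$ with $\lambda_1\ge\cdots\ge\lambda_n\ge0$; put $\lambda_{n+1}=0$. $e_j(x)$ is the $j$-th elementary symmetric function of $x_1,\ldots,x_n$, $\bar e_j(x)=e_j(x)/e_j(1,\ldots,1)=e_j(x)/\binom nj$, and $\bar E_\lambda(x)=\prod_{j=1}^n\bar e_j(x)^{\lambda_j-\lambda_{j+1}}$. The $\bar E_\lambda$ form a basis of the space $\mathbb{C}[x_1,\ldots,x_n]^{S_n}$ of symmetric polynomials. $Q_z$ maps $\mathbb{C}[x_1,\ldots,x_n]^{S_n}$ to $\mathbb{C}[x_1,\ldots,x_n]^{S_n}\otimes\mathbb{C}[z]$. For $k=0,\ldots,n$, $\rho_k$ is the specialization $(\rho_kf)(x_1,\ldots,x_k)=f(x_1,\ldots,x_k,1,\ldots,1)$; $\rho_0f=f(1,\ldots,1)$ and $\rho_n$ is the identity. In all products and compositions, the operators $Q_{z_j}$, $\rho_k$, $\mathcal A_k$ act on the $x$-variables and are extended linearly over polynomials in the remaining $z$-variables; in $\mathcal A_1\cdots\mathcal A_n$ the operator $\mathcal A_n$ acts first. *)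

(* Defs.v *)
From HB Require Import structures.
From mathcomp Require Import all_boot all_order all_fingroup all_algebra.
From mathcomp.multinomials Require Import mpoly.

Set Implicit Arguments.
Unset Strict Implicit.
Unset Printing Implicit Defensive.

Import GRing.Theory.
Local Open Scope ring_scope.

(* F[x_1, ..., x_n]^{S_n}.  Indices are shifted by one throughout: x_j and z_j
   are the variables 'X_i with i = j - 1. *)
Record sympoly (F : fieldType) (n : nat) := SymPoly {
  symval :> {mpoly F[n]};
  symvalP : symval \is symmetric
}.

HB.instance Definition _ F n := [isSub for @symval F n].
HB.instance Definition _ F n := [Choice of sympoly F n by <:].
HB.instance Definition _ F n := [SubChoice_isSubComNzRing of sympoly F n by <:].
HB.instance Definition _ F n := [SubZmodule_isSubLmodule of sympoly F n by <:].
HB.instance Definition _ F n :=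
  [SubNzRing_SubLmodule_isSubLalgebra of sympoly F n by <:].
HB.instance Definition _ F n := [SubLalgebra_isSubAlgebra of sympoly F n by <:].

(* F[x_1, ..., x_k]^{S_k} (x) F[z] is {poly sympoly F k}, on which F acts through
   the constants F -> sympoly F k. *)
Notation "{ 'linop' F , n -> k }" :=
  {linear sympoly F n -> {poly sympoly F k} | GRing.in_alg (sympoly F k) \; *:%R}
  (at level 0, F, n, k at level 40, format "{ 'linop'  F ,  n  ->  k }") : type_scope.

Definition tensor (F : fieldType) (n : nat) (f : sympoly F n) (p : {poly F}) :
    {poly sympoly F n} :=
  f *: map_poly (GRing.in_alg (sympoly F n)) p.

Definition ebar (F : fieldType) (n j : nat) : sympoly F n :=
  ('C(n, j)%:R)^-1 *: SymPoly (mesym_sym n F j).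

Definition is_partition (n : nat) (lam : n.-tuple nat) : bool := sorted geq lam.

(* lambda_(j+1) - lambda_(j+2); the default value of nth is lambda_(n+1) = 0. *)
Definition step (n : nat) (lam : n.-tuple nat) (j : nat) : nat :=
  (nth 0 lam j - nth 0 lam j.+1)%N.

Definition Ebar (F : fieldType) (n : nat) (lam : n.-tuple nat) : sympoly F n :=
  \prod_(j < n) ebar F n j.+1 ^+ step lam j.

(* Ebar_lambda(z, 1, ..., 1) *)
Definition q_part (F : fieldType) (n : nat) (lam : n.-tuple nat) : {poly F} :=
  mmap (@polyC F) (fun i : 'I_n => if i == 0%N :> nat then 'X else 1)
    (Ebar F lam).

(* (x_1, ..., x_k, 1, ..., 1) *)
Definition rho_point (F : fieldType) (n k : nat) :
    n.-tuple {mpoly F[k]} :=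
  [tuple (if insub (i : nat) is Some j then 'X_(j : 'I_k) else 1) | i < n].

Lemma rho_sym (F : fieldType) (n k : nat) (hk : (k <= n)%N) (f : sympoly F n) :
  f \mPo rho_point F n k \is symmetric.
Proof.
apply/issymP => s.
pose g (i : 'I_n) : 'I_n :=
  if insub (i : nat) is Some j then widen_ord hk (s (j : 'I_k)) else i.
have gE (i : 'I_n) (j : 'I_k) : i = j :> nat -> g i = s j :> nat.
  by move=> e; rewrite /g e valK.
have gN (i : 'I_n) : (k <= i)%N -> g i = i.
  by move=> h; rewrite /g insubF // ltnNge h.
have g_inj : injective g.
  move=> i i' /(congr1 val) /=.
  case: (ltnP i k) => h; case: (ltnP i' k) => h'.
  - rewrite (@gE i (Ordinal h)) // (@gE i' (Ordinal h')) // => /val_inj.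
    by move=> /perm_inj /(congr1 val) e; apply/val_inj.
  - rewrite (@gE i (Ordinal h)) // (gN i') // => e.
    by move: (ltn_ord (s (Ordinal h))); rewrite e ltnNge h'.
  - rewrite (gN i) // (@gE i' (Ordinal h')) // => e.
    by move: (ltn_ord (s (Ordinal h'))); rewrite -e ltnNge h.
  - by rewrite !gN // => /val_inj.
have tE (i : 'I_n) :
    msym s (tnth (rho_point F n k) i) = tnth (rho_point F n k) (perm g_inj i).
  rewrite !tnth_mktuple permE; have [h|h] := ltnP i k.
    rewrite (@gE i (Ordinal h)) // valK.
    rewrite (_ : insub _ = Some (Ordinal h)); last by rewrite insubT.
    rewrite msymX; congr ('X_[_]); apply/mnmP => l; rewrite !mnmE.
    by rewrite -(inj_eq (@perm_inj _ s)) permKV.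
  rewrite gN // insubF ?ltnNge ?h //; exact: msym1.
have /issymP /(_ (perm g_inj)) fE := symvalP f.
rewrite -{2}fE msym_mPo !comp_mpolyE linear_sum /=.
apply: eq_bigr => m _; rewrite linearZ /=; congr (_ *: _).
rewrite rmorph_prod /=; apply: eq_bigr => i _.
by rewrite rmorphXn /= tE [in RHS]tnth_mktuple.
Qed.

(* For k = 0 the target sympoly F 0 consists of constants, and rho_0 f is the
   constant f(1, ..., 1). *)
Definition rho (F : fieldType) (n k : nat) (hk : (k <= n)%N) (f : sympoly F n) :
    sympoly F k :=
  SymPoly (rho_sym hk f).

(* A polynomial in one variable z, read as a polynomial in z_i. *)
Definition in_var (S : comNzRingType) (n : nat) (i : 'I_n) (p : {poly S}) :
    {mpoly S[n]} :=
  (map_poly (@mpolyC n S) p).['X_i].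

(* The extension, linear over polynomials in z_1, ..., z_n, of the operator
   obtained from A by renaming its variable z into z_i. *)
Definition zext (S T : comNzRingType) (n : nat) (A : S -> {poly T}) (i : 'I_n)
    (G : {mpoly S[n]}) : {mpoly T[n]} :=
  \sum_(m <- msupp G) in_var i (A G@_m) * 'X_[m].

(* rho_0 Q_(z_1) ... Q_(z_n), with values in F[z_1, ..., z_n] identified with
   {mpoly (sympoly F 0)[n]}. *)
Definition sep_op (F : fieldType) (n : nat) (Q : sympoly F n -> {poly sympoly F n})
    (f : sympoly F n) : {mpoly (sympoly F 0)[n]} :=
  map_mpoly (rho (leq0n n)) (foldr (zext Q) f%:MP (enum 'I_n)).

(* A_1 A_2 ... A_m for m <= n; the operator A k is A_(k+1). *)
Fixpoint op_prod (F : fieldType) (n : nat)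
    (A : forall k : 'I_n, sympoly F k.+1 -> {poly sympoly F k}) (m : nat) :
    (m <= n)%N -> {mpoly (sympoly F m)[n]} -> {mpoly (sympoly F 0)[n]} :=
  match m with
  | 0 => fun _ => id
  | m'.+1 => fun h G => op_prod A (ltnW h) (zext (A (Ordinal h)) (Ordinal h) G)
  end.

(* rho_k Q_(z_(k+1)) = A rho_(k+1), the left-hand rho_k acting on coefficients. *)
Definition intertwines (F : fieldType) (n : nat)
    (Q : sympoly F n -> {poly sympoly F n})
    (k : 'I_n) (A : sympoly F k.+1 -> {poly sympoly F k}) : Prop :=
  forall f : sympoly F n,
    map_poly (rho (ltnW (ltn_ord k))) (Q f) = A (rho (ltn_ord k) f).

(* Main.v *)
From HB Require Import structures.
Require Import Defs.
From mathcomp Require Import all_boot all_order all_algebra.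
From mathcomp.multinomials Require Import mpoly.
From mathcomp Require Import complex reals.
From mathcomp Require Import ring.

(* The operator Q_z is the ring morphism e_j |-> (1 + j u) e_j with
   u = (z - 1) / n.  On the generating polynomial E_n(t) = \sum_j e_j t^j it is
   therefore E |-> E + u t E', while rho_k maps E_n to (1 + t)^(n - k) E_k.
   Hence, with d = n - k, both rho_(k-1) Q_z and rho_k send E_n to multiples of
   (1 + t)^d, and cancelling this factor shows that A_k has to be the ring
   morphism
     E_k |-> (1 + t) E_(k-1) + u t ((d + 1) E_(k-1) + (1 + t) E_(k-1)'),
   whose right-hand side has degree k in t and constant term 1, so that it does
   prescribe the values at e_1, ..., e_k.  Uniqueness is surjectivity of rho_k. *)

Set Implicit Arguments.
Unset Strict Implicit.
Unset Printing Implicit Defensive.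

Import GRing.Theory.
Local Open Scope ring_scope.

(** * Elementary symmetric polynomials as coefficients of a generating product *)

Lemma coef_prod_1DMX (S : comNzRingType) (n : nat) (x : 'I_n -> S) (j : nat) :
  (\prod_(i < n) (1 + (x i)%:P * 'X))`_j =
    \sum_(h : {set 'I_n} | #|h| == j) \prod_(i in h) x i.
Proof.
under eq_bigr do rewrite addrC.
(* The set [h] collects the indices whose factor contributes x_i t, so its size is the exponent of
   t. *)
rewrite bigA_distr coef_sum [RHS]big_mkcond; apply: eq_bigr => h _.
rewrite -big_mkcond /= big_split /= -rmorph_prod /= prodr_const.
by rewrite coefCM coefXn eq_sym; case: eqP; rewrite ?mulr1 ?mulr0.
Qed.

Lemma mmap_mesym (R : nzRingType) (S : comNzRingType) (f : {rmorphism R -> S})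
    (n : nat) (x : 'I_n -> S) (j : nat) :
  mmap f x (mesym n R j) = (\prod_(i < n) (1 + (x i)%:P * 'X))`_j.
Proof.
rewrite coef_prod_1DMX rmorph_sum; apply: eq_bigr => h _.
by rewrite rmorph_prod; apply: eq_bigr => i _; rewrite /= mmapX mmap1U.
Qed.

Lemma coef_1DX (S : comNzRingType) (n j : nat) :
  ((1 + 'X : {poly S}) ^+ n)`_j = 'C(n, j)%:R.
Proof.
rewrite exprDn coef_sum.
under eq_bigr do rewrite expr1n mul1r coefMn coefXn.
have [jn | nj] := ltnP j n.+1; last first.
  rewrite bin_small // big1 // => i _.
  by rewrite eq_sym ltn_eqF ?mul0rn // (leq_trans (ltn_ord i)).
rewrite (bigD1 (Ordinal jn)) //= eqxx big1 ?addr0 // => i.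
by rewrite -val_eqE /= eq_sym => /negPf ->; rewrite mul0rn.
Qed.

(** * Symmetric polynomials as a free algebra on e_1, ..., e_n *)

Definition elsym (F : fieldType) (n j : nat) : sympoly F n :=
  SymPoly (mesym_sym n F j).

Definition sym_of (F : fieldType) (n : nat) (t : {mpoly F[n]}) : sympoly F n :=
  mmap (in_alg (sympoly F n)) (fun i : 'I_n => elsym F n i.+1) t.

HB.instance Definition _ (F : fieldType) (n : nat) :=
  GRing.RMorphism.copy (@sym_of F n)
    (mmap (in_alg (sympoly F n)) (fun i : 'I_n => elsym F n i.+1)).

Lemma sym_ofC (F : fieldType) (n : nat) (c : F) : sym_of c%:MP_[n] = c%:A.
Proof. exact: mmapC. Qed.

Lemma sym_ofX (F : fieldType) (n : nat) (i : 'I_n) :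
  sym_of 'X_i = elsym F n i.+1.
Proof. by rewrite /sym_of mmapX mmap1U. Qed.

HB.instance Definition _ (F : fieldType) (n : nat) :=
  GRing.RMorphism.copy (@symval F n) val.

Lemma symval_sym_of (F : fieldType) (n : nat) (t : {mpoly F[n]}) :
  symval (sym_of t) = t \mPo [tuple mesym n F i.+1 | i < n].
Proof.
rewrite comp_mpolyEX /sym_of /mmap rmorph_sum; apply: eq_bigr => m _.
rewrite [in_alg _ _ * _]mulr_algl /= comp_mpolyX /mmap1 rmorph_prod.
by congr (_ *: _); apply: eq_bigr => i _; rewrite rmorphXn /= tnth_mktuple.
Qed.

(** Chosen by the existence half of the fundamental theorem of symmetric polynomials; the uniqueness
    half makes it a two-sided inverse of [sym_of], hence a ring morphism. *)
Definition sym_coord (F : fieldType) (n : nat) (p : sympoly F n) :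
    {mpoly F[n]} :=
  sval (sym_fundamental (symvalP p)).

Lemma sym_coordK (F : fieldType) (n : nat) :
  cancel (@sym_coord F n) (@sym_of F n).
Proof.
move=> p; apply/val_inj; rewrite /= symval_sym_of /sym_coord.
by case: sym_fundamental => t [].
Qed.

Lemma sym_ofK (F : fieldType) (n : nat) :
  cancel (@sym_of F n) (@sym_coord F n).
Proof.
move=> t; apply/(@msym_fundamental_un n F).
by rewrite -!symval_sym_of sym_coordK.
Qed.

HB.instance Definition _ (F : fieldType) (n : nat) :=
  GRing.isZmodMorphism.Build _ _ (@sym_coord F n)
    (can2_zmod_morphism (@sym_ofK F n) (@sym_coordK F n)).

HB.instance Definition _ (F : fieldType) (n : nat) :=
  GRing.isMonoidMorphism.Build _ _ (@sym_coord F n)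
    (can2_monoid_morphism (@sym_ofK F n) (@sym_coordK F n)).

(** Universal property of the free algebra: the images of the scalars and of e_1, ..., e_n can be
    prescribed at will. Both Q_z and A_k are built this way. *)
Definition sym_lift (F : fieldType) (n : nat) (T : comNzRingType)
    (g : F -> T) (h : 'I_n -> T) (p : sympoly F n) : T :=
  mmap g h (sym_coord p).

HB.instance Definition _ (F : fieldType) (n : nat) (T : comNzRingType)
    (g : {rmorphism F -> T}) (h : 'I_n -> T) :=
  GRing.RMorphism.copy (sym_lift g h) (mmap g h \o @sym_coord F n).

Lemma sym_liftC (F : fieldType) (n : nat) (T : comNzRingType)
    (g : {rmorphism F -> T}) (h : 'I_n -> T) (c : F) :
  sym_lift g h c%:A = g c.
Proof. by rewrite /sym_lift -sym_ofC sym_ofK mmapC. Qed.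

Lemma sym_lift_elsym (F : fieldType) (n : nat) (T : comNzRingType)
    (g : {rmorphism F -> T}) (h : 'I_n -> T) (i : 'I_n) :
  sym_lift g h (elsym F n i.+1) = h i.
Proof. by rewrite /sym_lift -sym_ofX sym_ofK mmapX mmap1U. Qed.

(** Additivity is all that is asked, because it will be applied to the operator [Q], which is only
    given as a linear map. *)
Lemma eq_additive_sympoly (F : fieldType) (n : nat) (T : zmodType)
    (f g : {additive sympoly F n -> T}) :
  (forall c (m : 'X_{1..n}),
     f (c *: \prod_(i < n) elsym F n i.+1 ^+ m i) =
     g (c *: \prod_(i < n) elsym F n i.+1 ^+ m i)) -> f =1 g.
Proof.
move=> fg p; rewrite -[p]sym_coordK /sym_of /mmap !raddf_sum.
by apply: eq_bigr => m _; rewrite [in_alg _ _ * _]mulr_algl; apply: fg.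
Qed.

Lemma eq_rmorph_sympoly (F : fieldType) (n : nat) (T : comNzRingType)
    (f g : {rmorphism sympoly F n -> T}) :
  (forall c : F, f c%:A = g c%:A) ->
  (forall i : 'I_n, f (elsym F n i.+1) = g (elsym F n i.+1)) -> f =1 g.
Proof.
move=> fgC fg; apply: eq_additive_sympoly => c m.
rewrite /= -mulr_algl !rmorphM /= fgC !rmorph_prod; congr (_ * _).
by apply: eq_bigr => i _; rewrite !rmorphXn /= fg.
Qed.

(** * The specializations rho_k and their effect on the generating polynomial *)

Lemma rho_is_zmod_morphism (F : fieldType) (n k : nat) (hk : (k <= n)%N) :
  zmod_morphism (rho (F := F) hk).
Proof. by move=> f g; apply/val_inj; rewrite raddfB; apply: raddfB. Qed.

Lemma rho_is_monoid_morphism (F : fieldType) (n k : nat) (hk : (k <= n)%N) :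
  monoid_morphism (rho (F := F) hk).
Proof.
split=> [|f g]; apply/val_inj; first by rewrite rmorph1; apply: rmorph1.
by rewrite rmorphM; apply: rmorphM.
Qed.

Lemma rho_is_scalable (F : fieldType) (n k : nat) (hk : (k <= n)%N) :
  scalable (rho (F := F) hk).
Proof. by move=> c f; apply/val_inj; apply: comp_mpolyZ. Qed.

HB.instance Definition _ (F : fieldType) (n k : nat) (hk : (k <= n)%N) :=
  GRing.isZmodMorphism.Build _ _ (rho (F := F) hk)
    (@rho_is_zmod_morphism F n k hk).

HB.instance Definition _ (F : fieldType) (n k : nat) (hk : (k <= n)%N) :=
  GRing.isMonoidMorphism.Build _ _ (rho (F := F) hk)
    (@rho_is_monoid_morphism F n k hk).

HB.instance Definition _ (F : fieldType) (n k : nat) (hk : (k <= n)%N) :=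
  GRing.isScalable.Build _ _ _ _ (rho (F := F) hk)
    (@rho_is_scalable F n k hk).

Lemma rho_id (F : fieldType) (n : nat) (f : sympoly F n) : rho (leqnn n) f = f.
Proof.
apply/val_inj; rewrite -[RHS]comp_mpoly_id; congr (_ \mPo _).
by apply/eq_from_tnth => i; rewrite !tnth_mktuple valK.
Qed.

Definition egen (F : fieldType) (k : nat) : {poly sympoly F k} :=
  \poly_(j < k.+1) elsym F k j.

Lemma coef_egen (F : fieldType) (k j : nat) : (egen F k)`_j = elsym F k j.
Proof.
rewrite coef_poly; case: ltnP => // kj.
by apply/val_inj; rewrite /= mesym_geqnE.
Qed.

Lemma elsym0 (F : fieldType) (k : nat) : elsym F k 0 = 1.
Proof. by apply/val_inj; rewrite /= mesym0E. Qed.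

Lemma eq_mmap (R S : nzRingType) (n : nat) (f : R -> S) (x y : 'I_n -> S)
    (p : {mpoly R[n]}) :
  x =1 y -> mmap f x p = mmap f y p.
Proof.
by move=> xy; rewrite /mmap; apply: eq_bigr => m _; rewrite (mmap1_eq _ xy).
Qed.

(** Each variable set to 1 turns its factor into 1 + t, and the coefficients of (1 + t)^(n - k) are
    binomials. The point [x] is indexed by [nat] so that the product can be cut at k. *)
Lemma mmap_mesym_pad1 (R : nzRingType) (S : comNzRingType)
    (f : {rmorphism R -> S}) (n k : nat) (hk : (k <= n)%N) (x : nat -> S)
    (x1 : forall i, (k <= i)%N -> x i = 1) (j : nat) :
  mmap f (fun i : 'I_n => x i) (mesym n R j) =
    \sum_(i < j.+1)
      'C(n - k, i)%:R * mmap f (fun l : 'I_k => x l) (mesym k R (j - i)).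
Proof.
rewrite mmap_mesym -(big_mkord xpredT (fun i => 1 + (x i)%:P * 'X)).
rewrite (big_cat_nat (n := k)) //= mulrC.
rewrite [X in X * _](_ : _ = (1 + 'X) ^+ (n - k)); last first.
  rewrite -prodr_const_nat; apply: eq_big_nat => i /andP[ki _].
  by rewrite x1 // mul1r.
by rewrite coefM big_mkord; apply: eq_bigr => i _; rewrite coef_1DX mmap_mesym.
Qed.

Lemma map_rho_egen (F : fieldType) (n k : nat) (hk : (k <= n)%N) :
  map_poly (rho hk) (egen F n) = (1 + 'X) ^+ (n - k) * egen F k.
Proof.
pose x i := if insub i is Some j then 'X_[F, U_(j : 'I_k)] else 1.
have x1 i : (k <= i)%N -> x i = 1 by move=> ki; rewrite /x insubF // ltnNge ki.
apply/polyP => j; rewrite coef_map coef_egen coefM; apply/val_inj.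
rewrite /= [RHS]rmorph_sum /=.
transitivity (mmap (@mpolyC k F) (fun i : 'I_n => x i) (mesym n F j)).
  by apply: eq_mmap => i; rewrite tnth_mktuple.
rewrite (mmap_mesym_pad1 _ hk x1); apply: eq_bigr => i _.
rewrite coef_1DX coef_egen rmorph_nat; congr (_ * _).
rewrite -[RHS]comp_mpoly_id; apply: eq_mmap => l.
by rewrite tnth_mktuple /x valK.
Qed.

(** * The operator E + u t E' and division by powers of 1 + t *)

Definition euler (S : comNzRingType) (u : S) (p : {poly S}) : {poly S} :=
  p + u *: ('X * p^`()).

(** t d/dt multiplies t^j by j; for u = (z - 1) / n the factor is the eigenvalue of Q_z at e_j. *)
Lemma coef_euler (S : comNzRingType) (u : S) (p : {poly S}) (j : nat) :
  (euler u p)`_j = (1 + j%:R * u) * p`_j.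
Proof.
rewrite coefD coefZ coefXM mulrDl mul1r; congr (_ + _).
case: j => [|j] /=; first by rewrite mul0r mul0r mulr0.
by rewrite coef_deriv -mulr_natr; ring.
Qed.

Definition euler_quot (S : comNzRingType) (u : S) (d : nat) (p : {poly S}) :
    {poly S} :=
  (1 + 'X) * p + u *: ('X * (d.+1%:R * p + (1 + 'X) * p^`())).

(** By the product rule, the derivative of (1 + t)^(d+1) p is (1 + t)^d ((d + 1) p + (1 + t) p'), so
    (1 + t)^d factors out. *)
Lemma euler_quotP (S : comNzRingType) (u : S) (d : nat) (p : {poly S}) :
  euler u ((1 + 'X) ^+ d.+1 * p) = (1 + 'X) ^+ d * euler_quot u d p.
Proof.
rewrite /euler /euler_quot derivM deriv_exp derivD derivC derivX -!mul_polyC.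
by rewrite -mulr_natl !exprS /=; ring.
Qed.

(** Multiplying by 1 + t or t raises the degree by at most one, and so does passing from p to t (1 +
    t) p'. *)
Lemma size_euler_quot (S : comNzRingType) (u : S) (d k : nat) (p : {poly S}) :
  (size p <= k -> size (euler_quot u d p) <= k.+1)%N.
Proof.
move=> /leq_sizeP pk; apply/leq_sizeP => -[//|j] kj.
rewrite /euler_quot !mulrDl !mul1r mulr_natl.
rewrite !(coefD, coefZ, coefXM, coefMn) /=.
have p0 i : (j <= i)%N -> p`_i = 0 by move=> ji; apply/pk/(leq_trans _ ji).
by case: j {kj} p0 => [|j] p0 /=;
  rewrite !coef_deriv !p0 ?leqnSn // ?mul0rn ?addr0 ?mulr0 ?addr0.
Qed.

Lemma coef0_euler_quot (S : comNzRingType) (u : S) (d : nat) (p : {poly S}) :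
  (euler_quot u d p)`_0 = p`_0.
Proof.
rewrite /euler_quot coefD coefZ coefXM mulr0 addr0 coef0M.
by rewrite coefD coef1 coefX addr0 mul1r.
Qed.

(** * Q_z and A_k as ring morphisms, and their exchange with rho *)

Definition scalars (F : fieldType) (n : nat) : {poly F} -> {poly sympoly F n} :=
  map_poly (in_alg (sympoly F n)).

HB.instance Definition _ (F : fieldType) (n : nat) :=
  GRing.RMorphism.copy (@scalars F n) (map_poly (in_alg (sympoly F n))).

Lemma map_rho_scalars (F : fieldType) (n k : nat) (hk : (k <= n)%N)
    (p : {poly F}) :
  map_poly (rho hk) (scalars n p) = scalars k p.
Proof. by apply/polyP => j; rewrite !coef_map /= linearZ rmorph1. Qed.

(** [u] stays a parameter, set to [qvar] only when matching q_lambda; the exchange with rho is an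
    identity in [u]. *)
Definition qop (F : fieldType) (n : nat) (u : {poly F}) :
    sympoly F n -> {poly sympoly F n} :=
  sym_lift (@polyC _ \o in_alg (sympoly F n))
    (fun i : 'I_n => scalars n (1 + i.+1%:R * u) * (elsym F n i.+1)%:P).

HB.instance Definition _ (F : fieldType) (n : nat) (u : {poly F}) :=
  GRing.RMorphism.copy (@qop F n u)
    (sym_lift (@polyC _ \o in_alg (sympoly F n))
      (fun i : 'I_n => scalars n (1 + i.+1%:R * u) * (elsym F n i.+1)%:P)).

Lemma qopC (F : fieldType) (n : nat) (u : {poly F}) (c : F) :
  qop u (c%:A : sympoly F n) = c%:A%:P.
Proof. exact: sym_liftC. Qed.

Lemma qop_elsym (F : fieldType) (n : nat) (u : {poly F}) (i : 'I_n) :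
  qop u (elsym F n i.+1) = scalars n (1 + i.+1%:R * u) * (elsym F n i.+1)%:P.
Proof. exact: sym_lift_elsym. Qed.

(* A_(k+1), for u = (z - 1) / n and d = n - (k + 1); the generating variable is
   the outer one of {poly {poly sympoly F k}}, and z the inner one. *)
Definition aop (F : fieldType) (k d : nat) (u : {poly F}) :
    sympoly F k.+1 -> {poly sympoly F k} :=
  sym_lift (@polyC _ \o in_alg (sympoly F k))
    (fun i : 'I_k.+1 =>
       (euler_quot (scalars k u) d (map_poly (@polyC _) (egen F k)))`_i.+1).

HB.instance Definition _ (F : fieldType) (k d : nat) (u : {poly F}) :=
  GRing.RMorphism.copy (@aop F k d u)
    (sym_lift (@polyC _ \o in_alg (sympoly F k))
    (fun i : 'I_k.+1 =>
       (euler_quot (scalars k u) d (map_poly (@polyC _) (egen F k)))`_i.+1)).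

Lemma aopC (F : fieldType) (k d : nat) (u : {poly F}) (c : F) :
  aop d u (c%:A : sympoly F k.+1) = c%:A%:P.
Proof. exact: sym_liftC. Qed.

(** [aop] prescribes the coefficients 1, ..., k + 1 only. The constant terms agree because e_0 = 1,
    and above degree k + 1 both sides vanish. *)
Lemma map_aop_egen (F : fieldType) (k d : nat) (u : {poly F}) :
  map_poly (@aop F k d u) (egen F k.+1) =
    euler_quot (scalars k u) d (map_poly (@polyC _) (egen F k)).
Proof.
apply/polyP => -[|j]; rewrite coef_map coef_egen.
  by rewrite coef0_euler_quot coef_map coef_egen !elsym0 /= rmorph1.
have [jk | kj] := ltnP j k.+1.
  exact: (sym_lift_elsym _ _ (Ordinal jk)).
have -> : elsym F k.+1 j.+1 = 0 by apply/val_inj; rewrite /= mesym_geqnE.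
rewrite /= rmorph0 nth_default //.
rewrite (leq_trans (@size_euler_quot _ _ _ k.+1 _ _)) //.
by rewrite size_map_polyC size_poly.
Qed.

(** Both sides are ring morphisms in f, so comparing them on e_1, ..., e_n, that is on the
    coefficients of E_n, is enough. *)
Lemma qop_aop (F : fieldType) (n k : nat) (hk : (k < n)%N) (u : {poly F})
    (f : sympoly F n) :
  map_poly (rho (ltnW hk)) (qop u f) = aop (n - k.+1) u (rho hk f).
Proof.
move: f; apply: (@eq_rmorph_sympoly F n _
  (map_poly (rho (ltnW hk)) \o @qop F n u) (aop (n - k.+1) u \o rho hk)).
  by move=> c /=; rewrite qopC map_polyC /= !linearZ !rmorph1 aopC.
move=> i /=.
(* On the coefficients of E_n, Q_z acts as [euler], and rho leaves the polynomials in z alone. *)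
transitivity (euler (scalars k u)
  (map_poly (@polyC _) (map_poly (rho (ltnW hk)) (egen F n))))`_i.+1.
  rewrite coef_euler !coef_map coef_egen qop_elsym rmorphM /= map_polyC.
  by rewrite map_rho_scalars rmorphD rmorphM rmorph1 rmorph_nat.
rewrite map_rho_egen rmorphM rmorphXn rmorphD rmorph1 /= map_polyX.
(* With d = n - (k + 1), rho_k gives the factor (1 + t)^(d + 1) and rho_(k+1) gives (1 + t)^d:
   exactly one power is absorbed by [euler_quot]. *)
rewrite -(subnSK hk) euler_quotP -map_aop_egen.
transitivity (map_poly (@aop F k (n - k.+1) u)
  (map_poly (rho hk) (egen F n)))`_i.+1.
  by rewrite map_rho_egen rmorphM rmorphXn rmorphD rmorph1 /= map_polyX.
by rewrite !coef_map coef_egen.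
Qed.

Lemma aop_is_scalable (F : fieldType) (k d : nat) (u : {poly F}) :
  scalable_for (in_alg (sympoly F k) \; *:%R) (@aop F k d u).
Proof. by move=> c f; rewrite -mulr_algl rmorphM /= aopC mul_polyC. Qed.

HB.instance Definition _ (F : fieldType) (k d : nat) (u : {poly F}) :=
  GRing.isScalable.Build F (sympoly F k.+1) {poly sympoly F k}
    (in_alg (sympoly F k) \; *:%R) (@aop F k d u) (@aop_is_scalable F k d u).

(** * Surjectivity of rho_k *)

Lemma rho_elsym (F : fieldType) (n k : nat) (hk : (k <= n)%N) (j : nat) :
  rho hk (elsym F n j) =
    \sum_(i < j.+1) 'C(n - k, i)%:R * elsym F k (j - i).
Proof.
rewrite -coef_egen -(coef_map (rho hk)) map_rho_egen coefM.
by apply: eq_bigr => i _; rewrite coef_1DX coef_egen.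
Qed.

(** rho_k is unitriangular on the e_j: it sends e_j to e_j plus a combination of e_i with i < j.
    Strong induction on j yields preimages of the generators. *)
Lemma rho_surj (F : fieldType) (n k : nat) (hk : (k <= n)%N) (g : sympoly F k) :
  exists f : sympoly F n, rho hk f = g.
Proof.
have im_elsym j : exists f : sympoly F n, rho hk f = elsym F k j.
  elim/ltn_ind: j => j IH.
  (* This is the image of e_j without its leading term, the one of index 0. *)
  have [f fE] : exists f : sympoly F n, rho hk f =
      \sum_(i < j) 'C(n - k, i.+1)%:R * elsym F k (j - i.+1).
    elim/big_ind: _ => [|_ _ [f <-] [f' <-]|i _].
    - by exists 0; rewrite rmorph0.
    - by exists (f + f'); rewrite rmorphD.
    - have ji : (j - i.+1 < j)%N.
        by rewrite ltn_subrL (leq_ltn_trans _ (ltn_ord i)).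
      have [f <-] := IH _ ji.
      by exists ('C(n - k, i.+1)%:R * f); rewrite rmorphM rmorph_nat.
  exists (elsym F n j - f).
  rewrite rmorphB /= rho_elsym big_ord_recl /= bin0 mul1r subn0 fE.
  by rewrite addrK.
have [h hE] := fin_all_exists (fun i : 'I_k => im_elsym i.+1).
(* The morphism sending each generator to a preimage is a section of rho. *)
exists (sym_lift (in_alg (sympoly F n)) h g).
move: g; apply: (@eq_rmorph_sympoly F k _
  (rho hk \o sym_lift (in_alg (sympoly F n)) h) idfun) => [c|i] /=.
  by rewrite sym_liftC linearZ rmorph1.
by rewrite sym_lift_elsym.
Qed.

(** * The eigenvalues q_lambda(z) and the identification of Q_z *)

Definition qvar (F : fieldType) (n : nat) : {poly F} := n%:R^-1 *: ('X - 1).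

Lemma pchar0_natr_neq0 (F : fieldType) (F0 : [pchar F] =i pred0) (n : nat) :
  (0 < n)%N -> n%:R != 0 :> F.
Proof. by rewrite (iffLR (pcharf0P F) F0) lt0n. Qed.

(** At (z, 1, ..., 1) the generating product is (1 + z t)(1 + t)^(n-1), so e_j becomes C(n-1, j) + z
    C(n-1, j-1). Dividing by C(n, j) leaves (1 - j/n) + z j/n. *)
Lemma mmap_ebar (F : fieldType) (F0 : [pchar F] =i pred0) (n : nat) (j : 'I_n) :
  mmap (@polyC F) (fun i : 'I_n => if i == 0%N :> nat then 'X else 1)
    (ebar F n j.+1) = 1 + j.+1%:R * qvar F n.
Proof.
case: n j => [[]//|n] j.
rewrite /ebar /= mmapZ mmap_mesym big_ord_recl /=.
rewrite (eq_bigr (fun _ => 1 + 'X)); last by move=> i _; rewrite mul1r.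
rewrite prodr_const card_ord mulrDl mul1r coefD -mulrA
  coefCM coefXM /= !coef_1DX.
have n0 := pchar0_natr_neq0 F0 (ltn0Sn n).
have c0 : 'C(n.+1, j.+1)%:R != 0 :> F.
  by apply: pchar0_natr_neq0; rewrite ?bin_gt0.
have cE : 'C(n, j)%:R = 'C(n.+1, j.+1)%:R * (j.+1%:R / n.+1%:R) :> F.
  apply: (mulfI n0); rewrite -natrM (mul_bin_diag n.+1 j) natrM.
  by field; rewrite nat1r.
have cD : 'C(n, j.+1)%:R = 'C(n.+1, j.+1)%:R - 'C(n, j)%:R :> F.
  by rewrite binS natrD addrK.
rewrite -!(rmorph_nat (@polyC F)) cD cE /qvar -mul_polyC.
set c := 'C(n.+1, j.+1)%:R in c0 *; set r := j.+1%:R / n.+1%:R.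
transitivity ((c^-1 * c)%:P * (1 + r%:P * ('X - 1))); first by ring.
by rewrite mulVf // mul1r polyCM mulrA.
Qed.

Lemma q_partE (F : fieldType) (F0 : [pchar F] =i pred0) (n : nat)
    (lam : n.-tuple nat) :
  q_part F lam = \prod_(j < n) (1 + j.+1%:R * qvar F n) ^+ step lam j.
Proof.
rewrite /q_part /Ebar rmorph_prod /= rmorph_prod /=; apply: eq_bigr => j _.
by rewrite !rmorphXn /= mmap_ebar.
Qed.

Lemma qop_ebar (F : fieldType) (n : nat) (u : {poly F}) (j : 'I_n) :
  qop u (ebar F n j.+1) = ebar F n j.+1 *: scalars n (1 + j.+1%:R * u).
Proof.
rewrite /ebar -mulr_algl rmorphM /= qopC qop_elsym.
by rewrite -[RHS]mul_polyC rmorphM /=; ring.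
Qed.

Lemma qop_Ebar (F : fieldType) (F0 : [pchar F] =i pred0) (n : nat)
    (lam : n.-tuple nat) :
  qop (qvar F n) (Ebar F lam) = tensor (Ebar F lam) (q_part F lam).
Proof.
rewrite /tensor -/(scalars n _) q_partE // /Ebar !rmorph_prod /= -mul_polyC.
rewrite rmorph_prod /= -big_split /=; apply: eq_bigr => j _.
by rewrite !rmorphXn /= qop_ebar -exprMn mul_polyC.
Qed.

(** The tail sums of [m] decrease and have [m] as successive differences. Thus every monomial in the
    ebar_j is some Ebar_lambda. *)
Lemma partition_of_mnm (n : nat) (m : 'X_{1..n}) :
  exists2 lam : n.-tuple nat,
    is_partition lam & forall j : 'I_n, step lam j = m j.
Proof.
pose g i := (\sum_(j < n | i <= j) m j)%N.
exists [tuple of mkseq g n].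
  have gW : {homo g : i i' / (i <= i')%N >-> (i >= i')%N}.
    move=> i i' ii'; rewrite /g big_mkcond [leqRHS]big_mkcond /=.
    by apply: leq_sum => l _; case: ifP => // /(leq_trans ii') ->.
  exact: (homo_sorted gW) (iota_sorted 0 n).
(* Past the end, the default 0 of [nth] agrees with the empty tail sum, so the last difference is
   also right. *)
have gE i : nth 0%N (mkseq g n) i = g i.
  have [?|ni] := ltnP i n; first by rewrite nth_mkseq.
  rewrite nth_default ?size_mkseq // /g big1 // => l il.
  by move: (ltn_ord l); rewrite ltnNge (leq_trans ni il).
move=> j; rewrite /step !gE /g (bigD1 j) //=.
rewrite [X in (_ + X)%N](_ : _ = \sum_(l < n | j < l) m l)%N ?addnK //.
by apply: eq_bigl => l; rewrite ltn_neqAle andbC eq_sym.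
Qed.

Lemma eigen_qop (F : fieldType) (F0 : [pchar F] =i pred0) (n : nat)
    (Q : {linop F, n -> n})
    (Q_Ebar : forall lam : n.-tuple nat, is_partition lam ->
      Q (Ebar F lam) = tensor (Ebar F lam) (q_part F lam)) :
  Q =1 qop (qvar F n).
Proof.
apply: (@eq_additive_sympoly F n _ Q (@qop F n (qvar F n))) => c m.
have [lam lamP stepE] := partition_of_mnm m.
have [b bE] : exists b : F,
    c *: \prod_(i < n) elsym F n i.+1 ^+ m i = b *: Ebar F lam.
  (* The binomials undo the normalization of the ebar_j. *)
  exists (c * \prod_(i < n) 'C(n, i.+1)%:R ^+ m i).
  rewrite -scalerA; congr (_ *: _).
  rewrite -mulr_algl -in_algE rmorph_prod -big_split /=; apply: eq_bigr => i _.
  rewrite stepE -in_algE rmorphXn -exprMn /= mulr_algl /ebar scalerA.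
  rewrite mulfV ?scale1r //.
  by rewrite pchar0_natr_neq0 // bin_gt0.
rewrite bE /= linearZ Q_Ebar // -qop_Ebar //.
by rewrite -[in RHS]mulr_algl rmorphM /= qopC mul_polyC.
Qed.

(** * Extension to polynomials in z_1, ..., z_n, and the separating operator on the Ebar_lambda *)

HB.instance Definition _ (S : comNzRingType) (n : nat) (i : 'I_n) :=
  GRing.RMorphism.copy (@in_var S n i)
    (horner_eval 'X_i \o map_poly (@mpolyC n S)).

Lemma in_varC (S : comNzRingType) (n : nat) (i : 'I_n) (c : S) :
  in_var i c%:P = c%:MP.
Proof. by rewrite /in_var map_polyC hornerC. Qed.

Lemma map_in_var (S T : comNzRingType) (n : nat) (g : {rmorphism S -> T})
    (i : 'I_n) (p : {poly S}) :
  map_mpoly g (in_var i p) = in_var i (map_poly g p).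
Proof.
rewrite /in_var -(map_mpolyX g U_(i)) -horner_map; congr _.[_].
rewrite -!map_poly_comp; apply: eq_map_poly => c /=.
by rewrite map_mpolyC.
Qed.

(** The support of [G] gives way to an index set depending on a size bound only, so that extensions
    at different polynomials can be compared term by term. *)
Lemma zextE (S T : comNzRingType) (n w : nat) (A : {additive S -> {poly T}})
    (i : 'I_n) (G : {mpoly S[n]}) (Gw : (msize G <= w)%N) :
  zext A i G = \sum_(m : 'X_{1..n < w}) in_var i (A G@_m) * 'X_[m].
Proof.
transitivity (mmap (in_var i \o A) (fun j => 'X_j) G).
  by rewrite /zext /mmap; apply: eq_bigr => m _; rewrite mmap1_id.
by rewrite (mmapE w Gw); apply: eq_bigr => m _; rewrite mmap1_id.
Qed.

Lemma zext_map (S S' T T' : comNzRingType) (n : nat)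
    (A : {additive S -> {poly T}}) (B : {additive S' -> {poly T'}})
    (f : {rmorphism S -> S'}) (g : {rmorphism T -> T'})
    (AB : forall s, map_poly g (A s) = B (f s)) (i : 'I_n) (G : {mpoly S[n]}) :
  map_mpoly g (zext A i G) = zext B i (map_mpoly f G).
Proof.
pose w := maxn (msize G) (msize (map_mpoly f G)).
rewrite (@zextE _ _ _ w A) ?leq_maxl // (@zextE _ _ _ w B) ?leq_maxr //.
rewrite rmorph_sum; apply: eq_bigr => m _.
by rewrite rmorphM /= map_in_var AB map_mpolyX mcoeff_map_mpoly.
Qed.

(** Linearity over polynomials in z with coefficients in [K]. In the iteration, [C] gathers the
    eigenvalues produced by the operators already applied. *)
Lemma zext_scalar (K S T : comNzRingType) (n : nat)
    (g : {rmorphism K -> S}) (h : {rmorphism K -> T})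
    (A : {additive S -> {poly T}})
    (A_lin : forall c s, A (g c * s) = (h c)%:P * A s)
    (i : 'I_n) (C : {mpoly K[n]}) (s : S) :
  zext A i (map_mpoly g C * s%:MP) = map_mpoly h C * in_var i (A s).
Proof.
pose w := maxn (msize (map_mpoly g C * s%:MP)) (msize C).
rewrite (@zextE _ _ _ w A) ?leq_maxl //.
rewrite [in RHS](@map_mpolyE _ _ _ _ C w) ?leq_maxr //.
rewrite [RHS]mulr_suml; apply: eq_bigr => m _.
rewrite [_ * s%:MP]mulrC mcoeffCM mulrC [s * _]mulrC mcoeff_map_mpoly A_lin.
by rewrite rmorphM /= in_varC -mul_mpolyC mulrCA mulrA.
Qed.

Lemma foldr_zext_eigen (K S : comNzRingType) (n : nat) (g : {rmorphism K -> S})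
    (A : {additive S -> {poly S}})
    (A_lin : forall c s, A (g c * s) = (g c)%:P * A s)
    (s : S) (p : {poly K}) (As : A s = s%:P * map_poly g p) (js : seq 'I_n) :
  foldr (zext A) s%:MP js = map_mpoly g (\prod_(j <- js) in_var j p) * s%:MP.
Proof.
elim: js => [|i js IH] /=; first by rewrite big_nil rmorph1 mul1r.
rewrite IH (zext_scalar A_lin) As rmorphM /= in_varC -map_in_var big_cons.
by rewrite rmorphM /= mulrA mulrC mulrA.
Qed.

Lemma map_mpoly_comp_eq (K S T : nzRingType) (n : nat) (f : {rmorphism K -> S})
    (g : {rmorphism S -> T}) (h : {rmorphism K -> T}) (P : {mpoly K[n]}) :
  (forall c, g (f c) = h c) -> map_mpoly g (map_mpoly f P) = map_mpoly h P.
Proof. by move=> gf; apply/mpolyP => m; rewrite !mcoeff_map_mpoly /= gf. Qed.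

(** In zero variables only e_0 survives, so rho_0 sends e_j to C(n, j), which the normalization of
    ebar_j cancels. *)
Lemma rho0_Ebar (F : fieldType) (F0 : [pchar F] =i pred0) (n : nat)
    (lam : n.-tuple nat) :
  rho (leq0n n) (Ebar F lam) = 1.
Proof.
rewrite /Ebar rmorph_prod big1 // => j _.
rewrite rmorphXn /= /ebar linearZ /=.
rewrite -[SymPoly _]/(elsym F n j.+1) rho_elsym.
rewrite (bigD1 ord_max) //= subnn elsym0 mulr1 subn0 big1 ?addr0.
  rewrite -scaler_nat scalerA mulVf ?scale1r ?expr1n //.
  by rewrite pchar0_natr_neq0 // bin_gt0.
move=> i; rewrite -val_eqE /= => ij.
have -> : elsym F 0 (j.+1 - i) = 0; last by rewrite mulr0.
apply/val_inj; rewrite /= mesym_geqnE // subn_gt0 ltn_neqAle ij.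
by rewrite -ltnS ltn_ord.
Qed.

Lemma sep_op_Ebar (F : fieldType) (F0 : [pchar F] =i pred0) (n : nat)
    (Q : {linop F, n -> n}) (lam : n.-tuple nat)
    (QE : Q (Ebar F lam) = tensor (Ebar F lam) (q_part F lam)) :
  sep_op Q (Ebar F lam) =
    map_mpoly (in_alg (sympoly F 0)) (\prod_(j < n) in_var j (q_part F lam)).
Proof.
have Q_lin (c : F) (f : sympoly F n) :
    Q (in_alg (sympoly F n) c * f) = (in_alg (sympoly F n) c)%:P * Q f.
  by rewrite mulr_algl linearZ mul_polyC.
have Qe : Q (Ebar F lam) =
    (Ebar F lam)%:P * map_poly (in_alg (sympoly F n)) (q_part F lam).
  by rewrite QE /tensor mul_polyC.
rewrite /sep_op (foldr_zext_eigen Q_lin Qe).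
rewrite rmorphM /= map_mpolyC /= rho0_Ebar // mulr1.
rewrite (map_mpoly_comp_eq (h := in_alg (sympoly F 0))).
  by rewrite big_enum.
by move=> c /=; rewrite linearZ rmorph1.
Qed.

(** * Factorization of the separating operator *)

Lemma zext_intertwines (F : fieldType) (n : nat) (Q : {linop F, n -> n})
    (k : 'I_n) (A : {linop F, k.+1 -> k}) (QA : intertwines Q A)
    (G : {mpoly (sympoly F n)[n]}) :
  zext A k (map_mpoly (rho (ltn_ord k)) G) =
    map_mpoly (rho (ltnW (ltn_ord k))) (zext Q k G).
Proof. exact: (esym (zext_map QA k G)). Qed.

Lemma op_prodS (F : fieldType) (n : nat)
    (A : forall k : 'I_n, sympoly F k.+1 -> {poly sympoly F k}) (m : nat)
    (hm : (m < n)%N) (G : {mpoly (sympoly F m.+1)[n]}) :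
  op_prod A hm G = op_prod A (ltnW hm) (zext (A (Ordinal hm)) (Ordinal hm) G).
Proof. by []. Qed.

(** By induction on m, each A_m rho_m is replaced by rho_(m-1) Q_(z_m) until rho_0 is reached.
    [foldr] lets the last index act first, in the same order as [op_prod]. *)
Lemma op_prod_rho (F : fieldType) (n : nat) (Q : {linop F, n -> n})
    (A : forall k : 'I_n, {linop F, k.+1 -> k})
    (QA : forall k : 'I_n, intertwines Q (A k)) (m : nat) (hm : (m <= n)%N)
    (G : {mpoly (sympoly F n)[n]}) :
  op_prod A hm (map_mpoly (rho hm) G) =
    map_mpoly (rho (leq0n n)) (foldr (zext Q) G (take m (enum 'I_n))).
Proof.
elim: m hm G => [|m IH] hm G.
  by rewrite take0; have -> : hm = leq0n n by apply: bool_irrelevance.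
have nthm : nth (Ordinal hm) (enum 'I_n) m = Ordinal hm.
  by apply/val_inj; rewrite /= nth_enum_ord.
rewrite (take_nth (Ordinal hm)) ?size_enum_ord // nthm foldr_rcons.
rewrite -(IH (ltnW hm)).
rewrite op_prodS; apply: (congr1 (op_prod A (ltnW hm))).
have := zext_intertwines (QA (Ordinal hm)) G.
(* [rho] carries the proof of its inequality, so the two proofs have to be identified. *)
have -> : ltn_ord (Ordinal hm) = hm by apply: bool_irrelevance.
by move=> QAm; apply: QAm.
Qed.

Lemma intertwines_aop (F : fieldType) (n : nat) (Q : {linop F, n -> n})
    (u : {poly F}) (Qu : Q =1 qop u) (k : 'I_n) :
  intertwines Q (@aop F k (n - k.+1) u).
Proof. by move=> f; rewrite Qu qop_aop. Qed.

Lemma intertwines_uniq (F : fieldType) (n : nat) (Q : {linop F, n -> n})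
    (k : 'I_n) (A B : sympoly F k.+1 -> {poly sympoly F k}) :
  intertwines Q A -> intertwines Q B -> A =1 B.
Proof.
by move=> QA QB g; have [f <-] := rho_surj (ltn_ord k) g; rewrite -QA -QB.
Qed.

(** The case m = n of [op_prod_rho], where rho_n is the identity. *)
Lemma sep_op_op_prod (F : fieldType) (n : nat) (Q : {linop F, n -> n})
    (A : forall k : 'I_n, {linop F, k.+1 -> k})
    (QA : forall k : 'I_n, intertwines Q (A k)) (f : sympoly F n) :
  sep_op Q f = op_prod A (leqnn n) f%:MP.
Proof.
rewrite -[in RHS](rho_id f) -(map_mpolyC n (rho (leqnn n))) (op_prod_rho QA).
by rewrite take_oversize // size_enum_ord.
Qed.

Theorem theorem3p1 (R : realType) (n : nat) (Q : {linop R[i], n -> n})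
    (Q_Ebar : forall lam : n.-tuple nat, is_partition lam ->
      Q (Ebar R[i] lam) = tensor (Ebar R[i] lam) (q_part R[i] lam)) :
  [/\ forall lam : n.-tuple nat, is_partition lam ->
        q_part R[i] lam =
          \prod_(j < n) (1 + (j.+1%:R / n%:R) *: ('X - 1)) ^+ step lam j,
      forall lam : n.-tuple nat, is_partition lam ->
        sep_op Q (Ebar R[i] lam) =
          map_mpoly (in_alg (sympoly R[i] 0))
            (\prod_(j < n) in_var j (q_part R[i] lam)),
      forall k : 'I_n, exists A : {linop R[i], k.+1 -> k},
        intertwines Q A /\
        forall A' : {linop R[i], k.+1 -> k}, intertwines Q A' -> A' =1 A
    & forall A : (forall k : 'I_n, {linop R[i], k.+1 -> k}),
        (forall k : 'I_n, intertwines Q (A k)) ->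
        forall f : sympoly R[i] n,
          sep_op Q f = op_prod A (leqnn n) f%:MP].
Proof.
have C0 : [pchar R[i]] =i pred0 by exact: Num.Theory.pchar_num.
split=> [lam _|lam lamP|k|A QA f].
- rewrite q_partE //; apply: eq_bigr => j _; congr ((1 + _) ^+ _).
  by rewrite /qvar -scalerA scaler_nat mulr_natl.
- exact: (sep_op_Ebar C0 (Q_Ebar lam lamP)).
- have QA := intertwines_aop (eigen_qop C0 Q_Ebar) k.
  by exists (@aop _ k (n - k.+1) (qvar _ n)); split=> // A' /intertwines_uniq;
    apply.
- exact: sep_op_op_prod.
Qed.
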